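(* **(a)** For all $n,p\in\mathbb{N}$ with $n>p$, $$m(n,p)=p+\left\lfloor \frac{p^2}{4(n-p)}\right\rfloor .$$ **(b)** For all $m,n\in\mathbb{N}$, $$p(m,n)=\left\lceil \frac{2}{3}\left(m+n-\sqrt{m^2+n^2-mn}\right)\right\rceil .$$
   Context: $\mathbb{N}=\{0,1,2,\ldots\}$. A lattice cell is a unit square $S(k,l)=[k-1,k]\times[l-1,l]$ with $k,l\in\mathbb{Z}$. A monotonically increasing polyomino is the union of a finite (nonempty) sequence of lattice cells $S_1,\ldots,S_q$ such that, for $j=1,\ldots,q-1$, if $S_j=S(k,l)$ then $S_{j+1}$ is either the right-hand neighbour $S(k+1,l)$ or the upper neighbour $S(k,l+1)$ of $S_j$; a monotonically decreasing polyomino is defined analogously, with the upper neighbour $S(k,l+1)$ replaced by the lower neighbour $S(k,l-1)$. A monotonous polyomino is one that is monotonically increasing or monotonically decreasing. For positive integers $m,n$ let $R_{m\times n}=[0,m]\times[0,n]$ (width $m$, height $n$), and put $R_{m\times n}=\emptyset$ if $\min\{m,n\}=0$. Coverings of $R_{m\times n}$ are by monotonous polyominoes contained in $R_{m\times n}$; $R_{m\times n}$ is covered by them if it is equal to their union (the empty rectangle needs no polyominoes). Define, for $m,n\in\mathbb{N}$, $p(m,n)=\min\{p\in\mathbb{N}: R_{m\times n}\text{ can be covered by } p\text{ monotonous polyominoes}\}$ (so $p(m,n)=0$ if $\min\{m,n\}=0$), and, for $n,p\in\mathbb{N}$, $m(n,p)=\sup\{m\in\mathbb{N}: R_{m\times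 n}\text{ can be covered by } p\text{ monotonous polyominoes}\}$. *)

(* Defs.v *)
From HB Require Import structures.
From mathcomp Require Import all_boot all_order all_algebra.
From mathcomp Require Import all_classical all_reals all_analysis.

Set Implicit Arguments.
Unset Strict Implicit.
Unset Printing Implicit Defensive.

Import Order.TTheory GRing.Theory Num.Theory.

Local Open Scope classical_set_scope.
Local Open Scope ring_scope.

(* Cells are indexed by their upper right corner. *)
Definition cell (R : realType) (c : int * int) : set (R * R) :=
  `[(c.1 - 1)%:~R, c.1%:~R]%classic `*` `[(c.2 - 1)%:~R, c.2%:~R]%classic.
Arguments cell : clear implicits.

Definition step_incr (c d : int * int) : bool :=
  (d == (c.1 + 1, c.2)) || (d == (c.1, c.2 + 1)).

Definition step_decr (c d : int * int) : bool :=
  (d == (c.1 + 1, c.2)) || (d == (c.1, c.2 - 1)).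

Definition polyomino_of (R : realType) (step : rel (int * int))
    (P : set (R * R)) : Prop :=
  exists (c : int * int) (s : seq (int * int)),
    path step c s /\ P = \bigcup_(d in [set` c :: s]) cell R d.

Definition monotonous (R : realType) (P : set (R * R)) : Prop :=
  polyomino_of step_incr P \/ polyomino_of step_decr P.

(* Degenerate rectangles are empty, not segments. *)
Definition rect (R : realType) (m n : nat) : set (R * R) :=
  if minn m n == 0%N then set0
  else `[0, m%:R]%classic `*` `[0, n%:R]%classic.
Arguments rect : clear implicits.

(* "Covered by p" is read as "by at most p".  Polyominoes may be repeated and
   are nonempty, so for a nonempty rectangle and p > 0 this is the same as
   "exactly p"; it makes the empty rectangle coverable by p for every p. *)
Definition coverable (R : realType) (m n p : nat) : Prop :=
  exists q : nat, (q <= p)%N /\ exists P : 'I_q -> set (R * R),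
    (forall i, monotonous (P i) /\ P i `<=` rect R m n) /\
    rect R m n = \bigcup_i P i.

Lemma nat_interval_cell (R : realType) (m : nat) (x : R) :
  (0 < m)%N -> 0 <= x <= m%:R -> exists i : 'I_m, i%:R <= x <= i.+1%:R.
Proof.
elim: m => // m IH _ /andP[x0 xm].
have [mx|xm'] := lerP m%:R x; first by exists ord_max; rewrite mx.
case: m => [|m] in IH xm xm' *.
  by move: (le_lt_trans x0 xm'); rewrite ltxx.
have [//||i hi] := IH; first by rewrite x0 ltW.
by exists (widen_ord (leqnSn _) i).
Qed.

Lemma coverable_cells (R : realType) (m n : nat) :
  coverable R m n (m * n).
Proof.
rewrite /coverable /rect; case: ifPn => [_|].
  exists 0%N; split=> //; exists (fun=> set0); split; first by case.
  by rewrite predeqE => x; split => // -[[]].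
rewrite -lt0n leq_min => /andP[m0 n0].
exists #|{: 'I_m * 'I_n}|; split; first by rewrite card_prod !card_ord.
pose C (u : 'I_m * 'I_n) : int * int := (u.1.+1%:Z, u.2.+1%:Z).
have cellE (u : 'I_m * 'I_n) (z : R * R) : cell R (C u) z <->
    (u.1%:R <= z.1 <= u.1.+1%:R) /\ (u.2%:R <= z.2 <= u.2.+1%:R).
  have e k : (k.+1%:Z - 1)%:~R = k%:R :> R.
    by rewrite intrB -!pmulrn -natr1 addrK.
  by rewrite /cell /= !in_itv /= !e -!pmulrn.
exists (fun i => cell R (C (enum_val i))); split.
  move=> i; split.
    left; exists (C (enum_val i)), [::]; split => //.
    by rewrite set_cons1 bigcup_set1.
  move=> z /cellE[/andP[a b] /andP[c d]].
  split; rewrite /= in_itv /=; apply/andP; split.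
  - by apply: le_trans a.
  - by apply: le_trans b _; rewrite ler_nat.
  - by apply: le_trans c.
  - by apply: le_trans d _; rewrite ler_nat.
rewrite predeqE => z; split.
  move=> [/=]; rewrite !in_itv /= => zx zy.
  have [i hi] := nat_interval_cell m0 zx; have [j hj] := nat_interval_cell n0 zy.
  by exists (enum_rank (i, j)) => //; rewrite enum_rankK; apply/cellE.
move=> [i _ /cellE[/andP[a b] /andP[c d]]].
split; rewrite /= in_itv /=; apply/andP; split.
- by apply: le_trans a.
- by apply: le_trans b _; rewrite ler_nat.
- by apply: le_trans c.
- by apply: le_trans d _; rewrite ler_nat.
Qed.

Lemma coverable_ex (R : realType) (m n : nat) :
  exists p : nat, `[< coverable R m n p >].
Proof. by exists (m * n)%N; apply/asboolP; exact: coverable_cells. Qed.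

Definition min_cover (R : realType) (m n : nat) : nat :=
  ex_minn (coverable_ex R m n).

(* Extended-real valued because the supremum is +oo when n <= p. *)
Definition max_width (R : realType) (n p : nat) : \bar R :=
  ereal_sup [set (m%:R)%:E | m in [set m : nat | coverable R m n p]].

(* Main.v *)
Require Import Defs.
From HB Require Import structures.
From mathcomp Require Import all_boot all_order all_algebra.
From mathcomp Require Import all_classical all_reals all_analysis.
From mathcomp Require Import zify ring lra.

Set Implicit Arguments.
Unset Strict Implicit.
Unset Printing Implicit Defensive.

Import Order.TTheory GRing.Theory Num.Theory.

Local Open Scope classical_set_scope.
Local Open Scope ring_scope.

(* Both parts say that p polyominoes suffice iff p >= min(m, n) or
   4 (m - p) (n - p) <= p^2.  Lower bound: let k increasing and l decreasing
   polyominoes cover the rectangle, k + l <= min(m, n).  Let f and g be the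
   heights of the union of the increasing, resp. decreasing, ones, evaluated
   at the lattice points (lengths of longest antichains in a quadrant).  On a
   cell, f increases along one diagonal by u and g along the other by v, with
   u, v in {0, 1}, and uv is at least the signed area of the quadrangle that
   (f, g) makes of the cell.  As u = 1 or v = 1, 1 <= u + v - uv.  Summing over
   the cells, u and v telescope to k (m + n - k) and l (m + n - l), and the
   area is that of a k x l rectangle, so that
   m n + k^2 + l^2 + k l <= (k + l) (m + n), that is,
   (m - k - l) (n - k - l) <= k l <= (k + l)^2 / 4.  Conversely, if
   a b <= k l, then k increasing and l decreasing chains cover a rectangle of
   size (a + k + l) x (b + k + l), by a Euclidean algorithm on (a, b, k, l). *)

(** * Longest increasing sequences of cells *)

Section Combinatorics.
Local Open Scope nat_scope.

(** Greatest length of a sequence of cells of [W] in [[0, x) x [0, y)] with both coordinates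
    strictly increasing, that is, of an antichain for decreasing chains. *)
Fixpoint lis (W : nat -> nat -> bool) (x : nat) : nat -> nat :=
  if x is x'.+1 then
    fix lis_row y := if y is y'.+1 then
      maxn (maxn (lis W x' y) (lis_row y')) (lis W x' y' + W x' y') else 0
  else fun=> 0.

Section Lis.
Variable W : nat -> nat -> bool.

Lemma lisn0 x : lis W x 0 = 0.
Proof. by case: x. Qed.

Lemma lisSS x y : lis W x.+1 y.+1 =
  maxn (maxn (lis W x y.+1) (lis W x.+1 y)) (lis W x y + W x y).
Proof. by []. Qed.

Lemma lis_leqSl x y : lis W x y <= lis W x.+1 y.
Proof. by case: y => [|y]; rewrite ?lisn0 // lisSS; lia. Qed.

Lemma lis_leqSr x y : lis W x y <= lis W x y.+1.
Proof. by case: x => [|x] //; rewrite lisSS; lia. Qed.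

Lemma lis_mono x y x' y' : x <= x' -> y <= y' -> lis W x y <= lis W x' y'.
Proof.
move=> xx' yy'; apply: (@leq_trans (lis W x' y)).
  elim: x' xx' => [|x' IH]; first by rewrite leqn0 => /eqP ->.
  rewrite leq_eqVlt => /orP[/eqP -> //|/IH h].
  exact: leq_trans h (lis_leqSl _ _).
elim: y' yy' => [|y' IH]; first by rewrite leqn0 => /eqP ->.
rewrite leq_eqVlt => /orP[/eqP -> //|/IH h].
exact: leq_trans h (lis_leqSr _ _).
Qed.

Lemma lis_gain x y : W x y -> lis W x y < lis W x.+1 y.+1.
Proof. by rewrite lisSS => ->; lia. Qed.

(** The added row and column together meet a strictly increasing sequence in at most one cell, its
    last. *)
Lemma lis_leqSS x y : lis W x.+1 y.+1 <= (lis W x y).+1.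
Proof.
elim: x y => [|x IHx] y.
  elim: y => [|y IHy]; rewrite lisSS /= ?lisn0; first by case: (W 0 0).
  by rewrite /= in IHy *; move: IHy; case: (W 0 _) => /=; lia.
elim: y => [|y IHy].
  by rewrite lisSS !lisn0; have := IHx 0; rewrite !lisn0; case: (W _ _); lia.
rewrite lisSS.
have := IHx y.+1; have := lis_leqSl x y.+1.
have := lis_leqSr x.+1 y.
have := leq_b1 (W x.+1 y.+1); lia.
Qed.

Lemma lis_leqr x y : lis W x y <= y.
Proof.
elim: y x => [|y IH] x; first by rewrite lisn0.
by case: x => [|x] //; apply: leq_trans (lis_leqSS _ _) _; rewrite ltnS.
Qed.

Lemma lis_leql x y : lis W x y <= x.
Proof.
elim: x y => [|x IH] y //.
case: y => [|y]; first by rewrite lisn0.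
by apply: leq_trans (lis_leqSS _ _) _; rewrite ltnS.
Qed.

(** The easy half of Dilworth's theorem. By induction, [lis] is at most the number of colours that
    occur on [W] in the quadrant, as a cell that extends a sequence brings a new colour. *)
Lemma lis_le_colors (m n k : nat) (c : nat -> nat -> nat) :
  (forall x y, x < m -> y < n -> W x y -> c x y < k) ->
  (forall x y x' y', x < x' < m -> y < y' < n -> W x y -> W x' y' ->
     c x y <> c x' y') ->
  forall x y, x <= m -> y <= n -> lis W x y <= k.
Proof.
move=> ck cP.
pose hit x y (s : 'I_k) := [exists i : 'I_x, exists j : 'I_y,
  W i j && (c i j == s)].
have hitP x y (s : 'I_k) : reflect (exists i j, [/\ i < x, j < y, W i j & c i j = s])
    (hit x y s).
  apply: (iffP existsP) => [[i /existsP[j /andP[Wij /eqP cs]]]|].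
    by exists i, j.
  move=> [i [j [ix jy Wij cs]]]; exists (Ordinal ix); apply/existsP.
  by exists (Ordinal jy); rewrite Wij cs /=.
have mono x y x' y' : x <= x' -> y <= y' -> #|hit x y| <= #|hit x' y'|.
  move=> xx' yy'; apply: subset_leq_card; apply/fintype.subsetP => s /hitP.
  move=> [i [j [ix jy Wij cs]]]; apply/hitP; exists i, j.
  by rewrite (leq_trans ix) // (leq_trans jy).
suff lis_hit x y : x <= m -> y <= n -> lis W x y <= #|hit x y|.
  move=> x y xm yn; apply: leq_trans (lis_hit _ _ xm yn) _.
  by rewrite -[leqRHS]card_ord max_card.
elim: x y => [|x IHx] y // xm; elim: y => [|y IHy] yn; first by rewrite lisn0.
rewrite lisSS !geq_max (leq_trans (IHx _ (ltnW xm) yn)) ?mono //=.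
rewrite (leq_trans (IHy (ltnW yn))) ?mono //=.
have := IHx y (ltnW xm) (ltnW yn).
case Wxy: (W x y); last by move=> h; rewrite addn0 (leq_trans h) ?mono.
move=> h; rewrite addn1 (leq_ltn_trans h) //; apply: proper_card.
apply/fintype.properP; split.
  apply/fintype.subsetP => s /hitP[i [j [ix jy Wij cs]]]; apply/hitP; exists i, j.
  by split=> //; exact: ltnW.
exists (Ordinal (ck _ _ xm yn Wxy)).
  by apply/hitP; exists x, y; rewrite !ltnSn.
apply/hitP => -[i [j [ix jy Wij /= cs]]].
by apply: (cP i j x y); rewrite ?ix ?jy.
Qed.

End Lis.

(** * Lower bound: corner functions summed over the grid *)

(* The height of a union of [k] chains, up to a reflection: the last two clauses
   prescribe its largest possible values on the boundary, as if the two corner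
   triangles of side [k] were part of the union. *)
Definition corner_function (m n k : nat) (f : nat -> nat -> nat) : Prop :=
  [/\ forall x y, f x y <= f x.+1 y, forall x y, f x y <= f x y.+1,
      forall x y, x < m -> y < n -> f x.+1 y.+1 <= (f x y).+1,
      forall y, y <= n -> f 0 y = 0 /\ f m y = minn k y &
      forall x, x <= m -> f x 0 = 0 /\ f x n = minn k x].

Lemma corner_function_exists (m n k : nat) (W : nat -> nat -> bool)
    (c : nat -> nat -> nat) : k <= m -> k <= n ->
  (forall x y, x < m -> y < n -> W x y -> c x y < k) ->
  (forall x y x' y', x < x' < m -> y < y' < n -> W x y -> W x' y' ->
     c x y <> c x' y') ->
  exists2 f, corner_function m n k f &
    forall x y, x < m -> y < n -> W x y -> f x.+1 y.+1 = (f x y).+1.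
Proof.
move=> km kn ck cP; have lisk := lis_le_colors ck cP.
exists (fun x y => maxn (lis W x y)
  (maxn (minn (k + x - m) y) (minn x (k + y - n)))).
  split.
  - by move=> x y; have := lis_leqSl W x y; lia.
  - by move=> x y; have := lis_leqSr W x y; lia.
  - by move=> x y xm yn; have := lis_leqSS W x y; lia.
  - move=> y yn; have := lis_leqr W m y; have := lisk m y (leqnn _) yn.
    by rewrite /=; split; lia.
  - move=> x xm; have := lis_leql W x n; have := lisk x n xm (leqnn _).
    by rewrite lisn0; split; lia.
(* Along the diagonal a positive corner term also rises by one, and a zero one by at most one, so
   the maximum rises by exactly one. *)
move=> x y xm yn Wxy; have := lis_gain Wxy; have := lis_leqSS W x y.
lia.
Qed.

(* Cells are indexed from 0 here; [U] singles out the cells that are covered by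
   increasing chains, and [c] numbers the chains of each kind. *)
Definition chain_cover (m n k l : nat) : Prop :=
  exists (U : nat -> nat -> bool) (c : nat -> nat -> nat),
  [/\ forall x y, x < m -> y < n -> c x y < if U x y then k else l,
      forall x y x' y', x < x' < m -> y' < y < n -> U x y -> U x' y' ->
        c x y <> c x' y' &
      forall x y x' y', x < x' < m -> y < y' < n -> ~~ U x y -> ~~ U x' y' ->
        c x y <> c x' y'].

Lemma sum_minnS (k n : nat) : k <= n ->
  2 * (\sum_(y < n) minn k y.+1) + k * k = 2 * (k * n) + k.
Proof.
have below j : j <= k -> 2 * (\sum_(y < j) minn k y.+1) = j * j.+1.
  elim: j => [|j IH] jk; first by rewrite big_ord0.
  by rewrite big_ord_recr /= mulnDr (IH (ltnW jk)) (minn_idPr jk); lia.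
elim: n => [|n IH] kn.
  by move: kn; rewrite leqn0 => /eqP ->; rewrite big_ord0.
move: kn; rewrite leq_eqVlt => /orP[/eqP <-|kn].
  by rewrite (below k (leqnn k)) mulnS; lia.
rewrite big_ord_recr /= mulnDr (minn_idPl (ltnW kn)) mulnS.
by move: (IH kn); move: (\sum_(y < n) _) => S; lia.
Qed.

Lemma sum_minn (k n : nat) : k <= n ->
  2 * (\sum_(y < n) minn k y) + k * k + k = 2 * (k * n).
Proof.
move=> kn; have := sum_minnS kn; case: n kn => [|n] kn.
  by rewrite !big_ord0; move: kn; rewrite leqn0 => /eqP ->.
rewrite big_ord_recr [in X in _ -> X]big_ord_recl /= minn0 add0n.
rewrite (minn_idPl kn) mulnDr.
have -> : \sum_(i < n) minn k (bump 0 i) = \sum_(i < n) minn k i.+1 by [].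
by move: (\sum_(y < n) _) => S; lia.
Qed.

(** A discrete Green formula: the terms of an inner edge cancel between the two cells that share
    it. *)
Lemma sum_grid_telescope (m n : nat) (P Q : nat -> nat -> int) :
  (\sum_(x < m) \sum_(y < n)
      (P x y.+1 - P x y + (Q x y - Q x.+1 y)) =
   \sum_(x < m) (P x n - P x 0%N) + \sum_(y < n) (Q 0%N y - Q m y))%R.
Proof.
under eq_bigr do rewrite big_split /=.
rewrite big_split /=; congr (_ + _)%R.
  apply: eq_bigr => x _; rewrite -(big_mkord xpredT (fun y => P x y.+1 - P x y)%R).
  by rewrite telescope_sumr.
rewrite exchange_big /=; apply: eq_bigr => y _.
rewrite -(big_mkord xpredT (fun x => Q x y - Q x.+1 y)%R).
rewrite -[LHS]opprK -sumrN; under eq_bigr do rewrite opprB.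
by rewrite telescope_sumr // opprB.
Qed.

(* [p * q - r * s] is twice the signed area of the quadrangle with diagonals
   [(p, s)] and [(r, q)], up to sign. *)
Lemma cell_inequality (p q r s : int) :
  (- p <= r <= p -> - q <= s <= q -> p <= 1 -> q <= 1 -> p = 1 \/ q = 1 ->
   2 <= 2 * p + 2 * q - (p * q - r * s))%R.
Proof.
move=> rp sq p1 q1 pq.
(* Behind the case analysis: [r * s >= - (p * q)], so the right-hand side is at least
   [2 - 2 * (1 - p) * (1 - q) = 2]. *)
have hp : (p = 0 \/ p = 1)%R by lia.
have hq : (q = 0 \/ q = 1)%R by lia.
have hr : (r = -1 \/ r = 0 \/ r = 1)%R by lia.
have hs : (s = -1 \/ s = 0 \/ s = 1)%R by lia.
by case: hp => ?; case: hq => ?; case: hr => [?|[?|?]]; case: hs => [?|[?|?]];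
  subst; lia.
Qed.

Lemma corner_functions_bound (m n k l : nat) (f g : nat -> nat -> nat) :
  k + l <= m -> k + l <= n ->
  corner_function m n k f -> corner_function m n l g ->
  (forall x y, x < m -> y < n ->
     f (m - x) y.+1 = (f (m - x.+1) y).+1 \/ g x.+1 y.+1 = (g x y).+1) ->
  m * n + k * k + l * l + k * l <= (k + l) * (m + n).
Proof.
move=> klm kln [fx fy fd f0m f0n] [gx gy gd g0m g0n] fg.
pose F x y : int := f (m - x) y; pose G x y : int := g x y.
(* [H] and [V] are the terms of the horizontal and vertical edges in the
   shoelace formula for the areas enclosed by [(F, G)]. *)
pose H x y : int := (F x y * G x.+1 y - F x.+1 y * G x y)%R.
pose V x y : int := (F x y * G x y.+1 - F x y.+1 * G x y)%R.
(* The diagonal gain of [F] is split at the corner [(x, y)] of the cell, that of [G] at [(x.+1, y)];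
   [P] belongs to horizontal edges and [Q] to vertical ones. *)
pose P x y : int := (2 * F x y + 2 * G x.+1 y - H x y)%R.
pose Q x y : int := (2 * F x y - 2 * G x y - V x y)%R.
have cell x y : x < m -> y < n ->
    (2 <= P x y.+1 - P x y + (Q x y - Q x.+1 y))%R.
  move=> xm yn.
  have -> : (P x y.+1 - P x y + (Q x y - Q x.+1 y) =
      2 * (F x y.+1 - F x.+1 y) + 2 * (G x.+1 y.+1 - G x y) -
      ((F x y.+1 - F x.+1 y) * (G x.+1 y.+1 - G x y) -
       (F x.+1 y.+1 - F x y) * (G x y.+1 - G x.+1 y)))%R.
    by rewrite /P /Q /H /V; ring.
  have mx : m - x = (m - x.+1).+1 by lia.
  have := fg _ _ xm yn; have := gx x y; have := gx x y.+1; have := gy x y.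
  have := gy x.+1 y; have := gd _ _ xm yn.
  have := fx (m - x.+1) y; have := fx (m - x.+1) y.+1.
  have := fy (m - x.+1) y; have := fy (m - x) y.
  have := @fd (m - x.+1) y; rewrite -mx => fd1.
  have {}fd1 := fd1 ltac:(lia) yn.
  rewrite /F /G => h1 h2 h3 h4 h5 h6 h7 h8 h9 h10.
  by apply: cell_inequality; clear -fd1 h1 h2 h3 h4 h5 h6 h7 h8 h9 h10; lia.
have top x : x < m -> (P x n - P x 0%N = 2 * (minn k (m - x))%:Z +
    2 * (minn l x.+1)%:Z - (l%:Z * (- (minn k (m - x.+1))%:Z - - (minn k (m - x))%:Z)
    + k%:Z * ((minn l x.+1)%:Z - (minn l x)%:Z)))%R.
  move=> xm; rewrite /P /H /F /G.
  have [-> ->] := f0n (m - x) (leq_subr _ _).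
  have [-> ->] := f0n (m - x.+1) (leq_subr _ _).
  have [-> ->] := g0n x.+1 xm; have [-> ->] := g0n x (ltnW xm).
  (* As [k + l <= m], [F] still equals [k] while [G] grows along the top edge, and then [G] stays at
     [l]; so the products turn into telescoping differences. *)
  have [xl|lx] := leqP x.+1 l.
    have -> : minn k (m - x) = k by lia.
    have -> : minn k (m - x.+1) = k by lia.
    by ring.
  have -> : minn l x = l by lia.
  by ring.
have side y : y < n -> (Q 0%N y - Q m y =
    2 * (minn k y)%:Z + 2 * (minn l y)%:Z)%R.
  move=> yn; rewrite /Q /V /F /G subn0 subnn.
  have [-> ->] := f0m y (ltnW yn); have [-> ->] := f0m y.+1 yn.
  have [-> ->] := g0m y (ltnW yn); have [-> ->] := g0m y.+1 yn.
  by ring.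
have tel (h : nat -> int) : (\sum_(x < m) (h x.+1 - h x) = h m - h 0%N)%R.
  by rewrite -(big_mkord xpredT (fun x => h x.+1 - h x)%R) telescope_sumr.
have sumZ N (h : nat -> nat) :
    (\sum_(x < N) (h x)%:Z = (\sum_(x < N) h x)%N%:Z)%R.
  by rewrite (big_morph Posz PoszD (erefl _)).
have km : k <= m by apply: leq_trans klm; exact: leq_addr.
have lm : l <= m by apply: leq_trans klm; exact: leq_addl.
have kn : k <= n by apply: leq_trans kln; exact: leq_addr.
have ln : l <= n by apply: leq_trans kln; exact: leq_addl.
have sumE : (2 * (m * n)%:Z <= 2 * (\sum_(x < m) minn k x.+1)%:Z +
    2 * (\sum_(x < m) minn l x.+1)%:Z - 2 * (l%:Z * k%:Z) +
    (2 * (\sum_(y < n) minn k y)%:Z + 2 * (\sum_(y < n) minn l y)%:Z))%R.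
  have -> : (2 * (m * n)%:Z = \sum_(x < m) \sum_(y < n) 2 :> int)%R.
    rewrite !sumr_const !card_ord -mulrnA -(mulr_natr (2 : int)%R (n * m)).
    by rewrite (natz (n * m)) mulnC.
  apply: (@le_trans _ _ (\sum_(x < m) \sum_(y < n)
      (P x y.+1 - P x y + (Q x y - Q x.+1 y)))%R).
    by apply: ler_sum => x _; apply: ler_sum => y _; exact: cell.
  rewrite sum_grid_telescope.
  under eq_bigr do rewrite top //.
  under [in X in (_ + X)%R]eq_bigr do rewrite side //.
  rewrite sumrB !big_split /= -!mulr_sumr.
  rewrite (tel (fun x => (minn l x)%:Z)) (tel (fun x => - (minn k (m - x))%:Z))%R.
  rewrite (_ : \sum_(x < m) (minn k (m - x))%:Z =
    \sum_(x < m) (minn k x.+1)%:Z)%R; last first.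
    rewrite (reindex_inj rev_ord_inj); apply: eq_bigr => x _ /=.
    by congr (Posz (minn k _)); have := ltn_ord x; lia.
  rewrite subnn subn0 !minn0 (minn_idPl km) (minn_idPl lm).
  rewrite (sumZ m (fun x => minn k x.+1)) (sumZ m (fun x => minn l x.+1)).
  rewrite (sumZ n (minn k)) (sumZ n (minn l)).
  move: (\sum_(x < m) _) (\sum_(x < m) _) => S1 S2.
  move: (\sum_(y < n) _) (\sum_(y < n) _) => S3 S4. lia.
have := sum_minnS km; have := sum_minnS lm.
have := sum_minn kn; have := sum_minn ln.
move: sumE.
move: (\sum_(x < m) _) (\sum_(x < m) _) => S1 S2.
by move: (\sum_(y < n) _) (\sum_(y < n) _) => S3 S4; lia.
Qed.

Lemma chain_cover_bound (m n k l : nat) : chain_cover m n k l ->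
  k + l <= m -> k + l <= n ->
  m * n + k * k + l * l + k * l <= (k + l) * (m + n).
Proof.
move=> [U [c [cb ci cd]]] klm kln.
(* Reflection turns antichains of increasing chains into sequences counted by [lis]. Cells reflect
   to [m.-1 - x], lattice points to [m - x]. *)
pose U' x y := U (m.-1 - x) y.
have [] := @corner_function_exists m n k U' (fun x y => c (m.-1 - x) y).
- by lia.
- by lia.
- by move=> x y xm yn Uxy; have := cb (m.-1 - x) y ltac:(lia) yn;
    rewrite -/(U' x y) Uxy.
- move=> x y x' y' xx' yy' Uxy Uxy'; apply/nesym/ci => //; lia.
move=> f fP fU.
have [] := @corner_function_exists m n l (fun x y => ~~ U x y) c.
- by lia.
- by lia.
- by move=> x y xm yn; have := cb x y xm yn; case: ifP.
- by move=> x y x' y' *; apply: cd.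
move=> g gP gU.
apply: (corner_functions_bound klm kln fP gP) => x y xm yn.
case Uxy: (U x y); last by right; apply: gU => //; rewrite Uxy.
left; have mx : m - x = (m - x.+1).+1 by lia.
rewrite {1}mx; apply: fU => //; first by lia.
by rewrite /U' (_ : m.-1 - (m - x.+1) = x) //; lia.
Qed.

(** * Construction of chain covers *)

(* The chain of the cell [(x, y)] is renumbered by the length of the longest
   antichain strictly to its right and below. *)
Lemma level_labels (m n k : nat) (U : nat -> nat -> bool)
    (c : nat -> nat -> nat) :
  (forall x y, x < m -> y < n -> U x y -> c x y < k) ->
  (forall x y x' y', x < x' < m -> y' < y < n -> U x y -> U x' y' ->
     c x y <> c x' y') ->
  exists d : nat -> nat -> nat,
    [/\ forall x y, x < m -> y < n -> U x y -> d x y < k,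
        forall x y, d x y <= y &
        forall x y x' y', x < x' < m -> y' < y < n -> U x y -> U x' y' ->
          d x' y' < d x y].
Proof.
move=> cb ci; pose U' x y := U (m.-1 - x) y.
have gain x y : x < m -> U x y ->
    lis U' (m.-1 - x) y < lis U' (m.-1 - x).+1 y.+1.
  move=> xm Uxy; apply: lis_gain.
  by rewrite /U' (_ : m.-1 - (m.-1 - x) = x) //; lia.
exists (fun x y => lis U' (m.-1 - x) y); split.
- move=> x y xm yn /(gain _ _ xm)/leq_trans; apply.
  apply: (@lis_le_colors U' m n k (fun x y => c (m.-1 - x) y)); [ | | lia | lia].
    by move=> i j im jn; apply: cb => //; lia.
  by move=> i j i' j' ii' jj' Uij Uij'; apply/nesym/ci => //; lia.
- by move=> x y; exact: lis_leqr.
move=> x y x' y' xx' yy' Uxy Uxy'.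
by apply: leq_trans (gain _ _ _ Uxy') _; [lia | apply: lis_mono; lia].
Qed.

Lemma chain_cover_tr (m n k l : nat) :
  chain_cover m n k l -> chain_cover n m k l.
Proof.
move=> [U [c [cb ci cd]]]; exists (fun x y => U y x), (fun x y => c y x).
split.
- by move=> x y xn ym; exact: cb.
- by move=> x y x' y' xx' yy' Uxy Uxy'; apply/nesym/ci.
- by move=> x y x' y' xx' yy' Uxy Uxy'; apply/cd.
Qed.

Lemma chain_cover_flip (m n k l : nat) :
  chain_cover m n k l -> chain_cover m n l k.
Proof.
move=> [U [c [cb ci cd]]].
exists (fun x y => ~~ U x (n.-1 - y)), (fun x y => c x (n.-1 - y)).
split.
- by move=> x y xm yn; have := cb x (n.-1 - y) xm ltac:(lia); case: ifP.
- by move=> x y x' y' xx' yy' Uxy Uxy'; apply/cd => //; lia.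
- by move=> x y x' y' xx' yy'; rewrite !negbK => Uxy Uxy'; apply/ci => //; lia.
Qed.

Lemma chain_cover_leq (m m' n k l : nat) : m <= m' ->
  chain_cover m' n k l -> chain_cover m n k l.
Proof.
move=> mm' [U [c [cb ci cd]]]; exists U, c; split.
- by move=> x y xm; apply: cb; lia.
- by move=> x y x' y' xx'; apply: ci; lia.
- by move=> x y x' y' xx'; apply: cd; lia.
Qed.

(** A column is both an increasing and a decreasing chain. *)
Lemma chain_cover_columns (m n k l : nat) : m <= k + l -> chain_cover m n k l.
Proof.
move=> mkl; exists (fun x _ => x < k), (fun x _ => if x < k then x else x - k).
by split=> [x y | x y x' y' | x y x' y']; do ?case: ifP; lia.
Qed.

(* In each of the first [k] columns one increasing chain climbs by [b] rows, the
   topmost one first; in each of the next [b] columns one decreasing chain,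
   the lowest one first, drops to one of the [b] bottom rows, which it follows
   to the right.  The smaller rectangle fills the remaining corner; the bounds
   of [level_labels] make its chains continue those on the left. *)
Lemma chain_cover_step (m k l b : nat) :
  chain_cover m (k + l + b) k l ->
  chain_cover (k + b + m) (k + l + b + b) k (l + b).
Proof.
move=> [U [c [cb ci cd]]].
have [||c1 [c1b c1y c1i]] := @level_labels m (k + l + b) k U c.
- by move=> x y xm yn Uxy; have := cb _ _ xm yn; rewrite Uxy.
- by [].
have [||c2 [c2b c2y c2i]] := @level_labels m (k + l + b) l
    (fun x y => ~~ U x ((k + l + b).-1 - y)) (fun x y => c x ((k + l + b).-1 - y)).
- move=> x y xm yn Uxy; have := cb x ((k + l + b).-1 - y) xm ltac:(lia).
  by rewrite (negbTE Uxy).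
- by move=> x y x' y' xx' yy' Uxy Uxy'; apply: cd => //; lia.
have c2V x y : x < m -> y < k + l + b -> ~~ U x y ->
    c2 x ((k + l + b).-1 - y) < l /\ c2 x ((k + l + b).-1 - y) <= (k + l + b).-1 - y.
  move=> xm yn Uxy; split=> //; apply: c2b => //; first by lia.
  by rewrite (_ : _ - _ = y) //; lia.
have c2d x y x' y' : x < x' < m -> y < y' < k + l + b -> ~~ U x y ->
    ~~ U x' y' -> c2 x' ((k + l + b).-1 - y') < c2 x ((k + l + b).-1 - y).
  move=> xx' yy' Uxy Uxy'; apply: c2i => //; first by lia.
    by rewrite (_ : _ - _ = y) //; lia.
  by rewrite (_ : _ - _ = y') //; lia.
pose V x y := if x < k then y < b + k
  else if x < k + b then false
  else if y < b then false else U (x - (k + b)) (y - b).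
pose d x y :=
  if x < k then
    if y < b + k then maxn (minn y (k.-1 - x)) (y - b) else y - b - k
  else if x < k + b then maxn (minn y (x - k)) (y - b - k)
  else if y < b then y
  else if U (x - (k + b)) (y - b) then c1 (x - (k + b)) (y - b)
  (* [c2] counts from the top, the labels on the left from the bottom; the first [b] labels belong
     to the bottom rows. *)
  else b + (l.-1 - c2 (x - (k + b)) ((k + l + b).-1 - (y - b))).
exists V, d; split.
- move=> x y xm yn; rewrite /V /d.
  case: (ltnP x k) => xk; first by case: (ltnP y (b + k)) => yb; lia.
  case: (ltnP x (k + b)) => xkb; first lia.
  case: (ltnP y b) => yb; first lia.
  case: ifP => Uxy; first by apply: c1b => //; lia.
  have := c2V (x - (k + b)) (y - b) ltac:(lia) ltac:(lia) (negbT Uxy).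
  by lia.
- move=> x y x' y' xx' yy'; rewrite /V /d.
  case: (ltnP x k) => xk.
    case: (ltnP y (b + k)) => yb // _.
    case: (ltnP x' k) => xk'.
      by case: (ltnP y' (b + k)) => yb' // _; lia.
    case: (ltnP x' (k + b)) => xkb' //.
    case: (ltnP y' b) => yb' // ->.
    by have := c1y (x' - (k + b)) (y' - b); lia.
  case: (ltnP x (k + b)) => xkb //.
  case: (ltnP y b) => yb // Uxy; rewrite Uxy.
  case: (ltnP x' k) => xk'; first by lia.
  case: (ltnP x' (k + b)) => xkb' //.
  case: (ltnP y' b) => yb' // Uxy'; rewrite Uxy'.
  have := c1i (x - (k + b)) (y - b) (x' - (k + b)) (y' - b) ltac:(lia)
    ltac:(lia) Uxy Uxy'.
  by lia.
- move=> x y x' y' xx' yy'; rewrite /V /d.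
  case: (ltnP x' k) => xk'.
    case: (ltnP y' (b + k)) => yb' // + _; case: (ltnP x k) => xk; last by lia.
    by case: (ltnP y (b + k)) => yb // _; lia.
  case: (ltnP x' (k + b)) => xkb'.
    move=> + _; case: (ltnP x k) => xk.
      by case: (ltnP y (b + k)) => yb // _; lia.
    by case: (ltnP x (k + b)) => xkb; lia.
  case: (ltnP y' b) => yb'.
    move=> + _; case: (ltnP x k) => xk.
      by case: (ltnP y (b + k)) => yb // _; lia.
    case: (ltnP x (k + b)) => xkb; first lia.
    by case: (ltnP y b) => yb //; lia.
  move=> + Uxy'; rewrite (negbTE Uxy').
  have := c2V (x' - (k + b)) (y' - b) ltac:(lia) ltac:(lia) Uxy'.
  move=> [el ey].
  case: (ltnP x k) => xk.
    by case: (ltnP y (b + k)) => yb // _; lia.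
  case: (ltnP x (k + b)) => xkb; first lia.
  case: (ltnP y b) => yb; first lia.
  move=> Uxy; rewrite (negbTE Uxy).
  have [fl fy] := c2V (x - (k + b)) (y - b) ltac:(lia) ltac:(lia) Uxy.
  have := c2d (x - (k + b)) (y - b) (x' - (k + b)) (y' - b) ltac:(lia)
    ltac:(lia) Uxy Uxy'.
  lia.
Qed.

(* A subtractive Euclidean algorithm: [chain_cover_step] trades [(a, l)] for
   [(a - k, l - b)], and transposing and flipping the rectangle trades
   [(b, k)] for [(b - l, k - a)]. *)
Lemma chain_cover_exists (a b k l : nat) : a * b <= k * l ->
  chain_cover (a + (k + l)) (b + (k + l)) k l.
Proof.
have step m' k' l' b' : b' <= l' ->
    chain_cover m' (b' + (k' + (l' - b'))) k' (l' - b') ->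
    chain_cover (k' + b' + m') (b' + (k' + l')) k' l'.
  move=> bl; have := @chain_cover_step m' k' (l' - b') b'.
  rewrite subnK // (_ : _ + _ + b' + b' = b' + (k' + l')); last by lia.
  by rewrite (_ : _ + _ + b' = b' + (k' + (l' - b'))) //; lia.
have [s] := ubnP (a + b + k + l); elim: s a b k l => // s IH a b k l abkl ab.
have [a0|a_gt0] := posnP a.
  by apply: chain_cover_columns; lia.
have [b0|b_gt0] := posnP b.
  by apply/chain_cover_tr/chain_cover_columns; lia.
have : 0 < k * l by apply: leq_trans ab; rewrite muln_gt0 a_gt0.
rewrite muln_gt0 => /andP[k_gt0 l_gt0].
have main a' b' k' l' : a' + b' + k' + l' < s.+1 -> 0 < k' -> a' * b' <= k' * l' ->
    k' <= a' -> b' <= l' -> chain_cover (a' + (k' + l')) (b' + (k' + l')) k' l'.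
  move=> lts k0 ab' ka bl.
  rewrite (_ : a' + _ = k' + b' + (a' - k' + (k' + (l' - b')))); last by lia.
  by apply: step => //; apply: IH; rewrite ?mulnBl ?mulnBr; lia.
have [bl|lb] := leqP b l; have [ka|ak] := leqP k a.
- exact: main.
(* The Euclidean step overshoots: columns cover the smaller rectangle, and the result is wide enough
   because [a < k]. *)
- apply: (@chain_cover_leq _ (k + b + (k + (l - b)))); first by lia.
  by apply: step => //; apply: chain_cover_columns; lia.
- have := leq_mul lb ka; have : k * l < k * l.+1 by rewrite ltn_pmul2l.
  lia.
- by apply/chain_cover_tr/chain_cover_flip; rewrite (addnC k); apply: main; lia.
Qed.

Lemma chain_cover_width (m n p : nat) :
  (exists k l, k + l <= p /\ chain_cover m n k l) <->
  4 * (m - p) * (n - p) <= p * p.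
Proof.
split=> [[k [l [klp klP]]]|mnp].
  have [mp|pm] := leqP m p; first by rewrite (eqP mp) muln0.
  have [np|pn] := leqP n p; first by rewrite (eqP np) muln0.
  have := chain_cover_bound klP ltac:(lia) ltac:(lia).
  have : (m - p) * (n - p) <= (m - (k + l)) * (n - (k + l)).
    by apply: leq_mul; lia.
  have mE : m = m - (k + l) + (k + l) by lia.
  have nE : n = n - (k + l) + (k + l) by lia.
  move: (m - (k + l)) (n - (k + l)) mE nE => a b -> -> h1 h2.
  (* With [m = a + k + l] and [n = b + k + l], this is [chain_cover_bound] rearranged. *)
  have h3 : a * b <= k * l by nia.
  have h4 : 4 * (k * l) <= (k + l) * (k + l) by rewrite mulnn; exact: nat_AGM2.
  have h5 : (k + l) * (k + l) <= p * p by apply: leq_mul.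
  lia.
have [mp|pm] := leqP m p.
  by exists p, 0; rewrite addn0; split=> //; apply: chain_cover_columns; lia.
have [np|pn] := leqP n p.
  exists p, 0; rewrite addn0; split=> //.
  by apply/chain_cover_tr/chain_cover_columns; lia.
(* The balanced split makes the product the integer part of [p * p / 4], so no integer is lost. *)
exists p./2, (p - p./2); have p2 : p./2 + (p - p./2) = p by lia.
split; first by rewrite p2.
have := @chain_cover_exists (m - p) (n - p) p./2 (p - p./2).
rewrite p2 !subnK; [apply | lia | lia].
have := odd_double_half p; move: mnp p2; move: (m - p) (n - p) => a b.
move: (p - _) => l; move: (p./2) (odd p) => k o; rewrite -mul2n => h pE poE.
have : l = k + o by lia.
rewrite -pE in h; move=> lE; subst l; move: h; rewrite -mulnA; move: (a * b) => ab.
by case: o {poE pE} => /=; nia.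
Qed.

(** The path is built backwards from [(m, n)]: it arrives from the left if [T] has no cell below
    [(m, n)] in column [m], from below if it has none to the left in row [n]. If both fail, two such
    cells violate the chain condition. *)
Lemma chain_path (m n : nat) (T : nat -> nat -> bool) :
  (forall x y x' y', x < x' <= m -> y' < y <= n -> T x y -> T x' y' -> False) ->
  exists s : seq (nat * nat),
    [/\ path (fun c d => (d == (c.1.+1, c.2)) || (d == (c.1, c.2.+1))) (0, 0) s,
        last (0, 0) s = (m, n),
        all (fun c => (c.1 <= m) && (c.2 <= n)) ((0, 0) :: s) &
        forall x y, x <= m -> y <= n -> T x y -> (x, y) \in (0, 0) :: s].
Proof.
have [N] := ubnP (m + n); elim: N m n => // N IH m n mnN chainT.
have noneP (A : pred nat) j : ~~ has A (iota 0 j) ->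
    forall i, i < j -> A i = false.
  by move=> /hasPn h i ij; apply/negbTE/h; rewrite mem_iota.
case hasc: ((0 < m) && ~~ has (T m) (iota 0 n)).
  case/andP: hasc; case: m => // m in mnN chainT * => _ /noneP colT.
  have [||s [sp sl sb sT]] := IH m n; first by lia.
    by move=> x y x' y' xx' yy'; apply: chainT => //; lia.
  exists (rcons s (m.+1, n)); split.
  - by rewrite rcons_path sp sl /= eqxx.
  - by rewrite last_rcons.
  - rewrite -rcons_cons all_rcons /= !leqnn /=.
    by apply: sub_all (sb : all _ s) => c /andP[cm ->]; rewrite leqW.
  move=> x y; rewrite -rcons_cons mem_rcons inE leq_eqVlt.
  case/orP => [/eqP -> | xm] yn Txy; last by rewrite sT ?orbT.
  have [yn'|ny] := ltnP y n; first by rewrite colT in Txy.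
  by rewrite (_ : y = n) ?eqxx //; lia.
case hasr: ((0 < n) && ~~ has (T^~ n) (iota 0 m)).
  case/andP: hasr; case: n => // n in mnN chainT hasc * => _ /noneP rowT.
  have [||s [sp sl sb sT]] := IH m n; first by lia.
    by move=> x y x' y' xx' yy'; apply: chainT => //; lia.
  exists (rcons s (m, n.+1)); split.
  - by rewrite rcons_path sp sl /= eqxx orbT.
  - by rewrite last_rcons.
  - rewrite -rcons_cons all_rcons /= !leqnn /=.
    by apply: sub_all (sb : all _ s) => c /andP[-> cn]; rewrite leqW.
  move=> x y xm; rewrite -rcons_cons mem_rcons inE leq_eqVlt.
  case/orP => [/eqP -> | yn] Txy; last by rewrite sT ?orbT.
  have [xm'|mx] := ltnP x m; first by rewrite rowT in Txy.
  by rewrite (_ : x = m) ?eqxx //; lia.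
case: m => [|m] in mnN chainT hasc hasr *.
  case: n => [|n] in mnN chainT hasc hasr *; last by [].
  exists [::]; split=> // x y; rewrite !leqn0 => /eqP -> /eqP -> _.
  by rewrite inE.
case: n => [|n] in mnN chainT hasc hasr *; first by [].
move/negbFE/hasP: hasc => [y]; rewrite mem_iota => /andP[_ yn] Ty.
move/negbFE/hasP: hasr => [x]; rewrite mem_iota => /andP[_ xm] Tx.
by exfalso; apply: (chainT x n.+1 m.+1 y) => //; lia.
Qed.
End Combinatorics.

Lemma path_total (T : eqType) (e : rel T) (c : T) (s : seq T) :
  reflexive e -> transitive e -> path e c s ->
  {in c :: s &, forall x y, e x y || e y x}.
Proof.
move=> er et; elim: s c => [|d s IH] c cds x y.
  by rewrite !inE => /eqP -> /eqP ->; rewrite er.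
have /allP cs := order_path_min et cds; move: cds => /= /andP[_ ds].
rewrite (in_cons c (d :: s) x) (in_cons c (d :: s) y).
case/predU1P => [->|xs]; case/predU1P => [->|ys].
- by rewrite er.
- by rewrite (cs _ ys).
- by rewrite (cs _ xs) orbT.
- exact: (IH d ds).
Qed.

(** * Polyominoes in the plane and chains of cells *)

Section Geometry.
Variable R : realType.

Lemma cellP (i j : nat) (z : R * R) : cell R (i.+1%:Z, j.+1%:Z) z <->
  (i%:R <= z.1 <= i.+1%:R) /\ (j%:R <= z.2 <= j.+1%:R).
Proof.
have e k : (k.+1%:Z - 1)%:~R = k%:R :> R.
  by rewrite intrB -!pmulrn -natr1 addrK.
by rewrite /cell /= !in_itv /= !e -!pmulrn.
Qed.

Lemma cell_sub_rect (m n i j : nat) : (i < m)%N -> (j < n)%N ->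
  cell R (i.+1%:Z, j.+1%:Z) `<=` rect R m n.
Proof.
move=> im jn z /cellP[/andP[a b] /andP[c d]].
rewrite /rect ifF; last by lia.
split; rewrite /= in_itv /=; apply/andP; split.
- by apply: le_trans a.
- by apply: le_trans b _; rewrite ler_nat.
- by apply: le_trans c.
- by apply: le_trans d _; rewrite ler_nat.
Qed.

Lemma rect_cell (m n : nat) (z : R * R) : rect R m n z ->
  exists i j : nat, [/\ (i < m)%N, (j < n)%N & cell R (i.+1%:Z, j.+1%:Z) z].
Proof.
rewrite /rect; case: ifPn => // mn [/=]; rewrite !in_itv /= => zx zy.
have [i hi] := nat_interval_cell (ltac:(lia) : 0 < m)%N zx.
have [j hj] := nat_interval_cell (ltac:(lia) : 0 < n)%N zy.
by exists i, j; split=> //; apply/cellP.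
Qed.

(** A point that lies in no other cell: a union of cells containing it must use this cell. *)
Definition center (i j : nat) : R * R := (i%:R + 2^-1, j%:R + 2^-1).

Lemma center_cell (i j : nat) : cell R (i.+1%:Z, j.+1%:Z) (center i j).
Proof. by apply/cellP; rewrite /= -(@natr1 R i) -(@natr1 R j); split; lra. Qed.

Lemma center_cell_inj (i j : nat) (d : int * int) :
  cell R d (center i j) -> d = (i.+1%:Z, j.+1%:Z).
Proof.
have coord (a : int) (k : nat) :
    (a - 1)%:~R <= (k%:R + 2^-1 : R) <= a%:~R -> a = k.+1%:Z.
  rewrite intrB => /andP[h1 h2].
  have h3 : (a%:~R < (k.+2%:Z)%:~R :> R)
    by rewrite -!pmulrn -(@natr1 R k.+1) -(@natr1 R k); lra.
  have h4 : (k%:Z)%:~R < a%:~R :> R by rewrite -!pmulrn; lra.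
  move: h3 h4; rewrite !ltr_int; lia.
by case: d => a b [/=]; rewrite !in_itv /= => /coord -> /coord ->.
Qed.

Lemma chain_polyomino (b : bool) (m n : nat) (T : nat -> nat -> bool) :
  (0 < m)%N -> (0 < n)%N ->
  (forall x y x' y', (x < x' < m)%N -> (y < n)%N -> (y' < n)%N ->
     (if b then y' < y else y < y')%N -> T x y -> T x' y' -> False) ->
  exists P : set (R * R), [/\ monotonous P, P `<=` rect R m n &
    forall x y, (x < m)%N -> (y < n)%N -> T x y ->
      cell R (x.+1%:Z, y.+1%:Z) `<=` P].
Proof.
case: m => // m _; case: n => // n _ chainT.
(* Turning the rows upside down reduces decreasing chains to increasing ones; [n] is now the index
   of the top row. *)
pose r y := if b then y else (n - y)%N.
have [|s [sp sl sb sT]] := @chain_path m n (fun x y => T x (r y)).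
  move=> x y x' y' xx' yy'; apply: chainT; rewrite /r.
  - by lia.
  - by case: (b); lia.
  - by case: (b); lia.
  - by case: (b); lia.
pose f (c : nat * nat) : int * int :=
  (c.1.+1%:Z, if b then c.2.+1%:Z else n.+1%:Z - c.2%:Z).
have fE x y : (y <= n)%N -> f (x, y) = (x.+1%:Z, (r y).+1%:Z).
  by move=> yn; rewrite /f /r; case: (b) => //=; congr (_, _); lia.
exists (\bigcup_(d in [set` map f ((0, 0)%N :: s)]) cell R d); split.
- have mono (step : rel (int * int)) :
      (forall c d, (d == (c.1.+1, c.2)) || (d == (c.1, c.2.+1)) ->
      step (f c) (f d)) -> polyomino_of step
      (\bigcup_(d in [set` map f ((0, 0)%N :: s)]) cell R d).
    move=> fstep; exists (f (0, 0)%N), (map f s); split=> //.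
    exact: homo_path sp.
  rewrite /monotonous; case eb: b.
    left; apply: mono => c d /orP[/eqP -> | /eqP ->]; apply/orP;
      [left | right]; by rewrite /f eb; apply/eqP; congr (_, _); rewrite /=; lia.
  right; apply: mono => c d /orP[/eqP -> | /eqP ->]; apply/orP;
    [left | right]; by rewrite /f eb; apply/eqP; congr (_, _); rewrite /=; lia.
- move=> z [d /mapP[[x y] xys ->]].
  have /andP[/= xm yn] := allP sb _ xys.
  by rewrite fE //; apply: cell_sub_rect; rewrite ?ltnS // /r; case: (b); lia.
move=> x y xm yn Txy z zc.
exists (f (x, r y)); last first.
  rewrite fE; last by rewrite /r; case: (b); lia.
  by rewrite (_ : r (r y) = y) // /r; case: (b); lia.
apply/map_f/sT => //; first by rewrite /r; case: (b); lia.
by rewrite (_ : r (r y) = y) // /r; case: (b); lia.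
Qed.

Definition monotone_chain (b : bool) (s : seq (int * int)) : Prop :=
  forall c d, c \in s -> d \in s -> c.1 < d.1 ->
    if b then c.2 <= d.2 else d.2 <= c.2.

(** The steps lie in a reflexive transitive relation, so any two cells of the path are comparable.
    Direction and cells form one witness, to be selected by [choice]. *)
Lemma monotonous_chain (P : set (R * R)) : monotonous P ->
  exists bs : bool * seq (int * int),
    monotone_chain bs.1 bs.2 /\ P = \bigcup_(d in [set` bs.2]) cell R d.
Proof.
move=> [] [c [s [cs ->]]].
  pose e (u v : int * int) := (u.1 <= v.1) && (u.2 <= v.2).
  have er : reflexive e by move=> u; rewrite /e !lexx.
  have et : transitive e.
    by move=> u v w /andP[a b] /andP[a' b']; rewrite /e (le_trans a) ?(le_trans b).
  have cse : path e c s.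
    apply: sub_path cs => u v /orP[] /eqP -> /=; rewrite /e /= lexx ?andbT; lia.
  exists (true, c :: s); split=> // d d' ds ds' /= dd'.
  by have /orP[/andP[]|/andP[]] := path_total er et cse ds ds' => //; lia.
pose e (u v : int * int) := (u.1 <= v.1) && (v.2 <= u.2).
have er : reflexive e by move=> u; rewrite /e !lexx.
have et : transitive e.
  by move=> u v w /andP[a b] /andP[a' b']; rewrite /e (le_trans a) ?(le_trans b').
have cse : path e c s.
  apply: sub_path cs => u v /orP[] /eqP -> /=; rewrite /e /= lexx ?andbT; lia.
exists (false, c :: s); split=> // d d' ds ds' /= dd'.
by have /orP[/andP[]|/andP[]] := path_total er et cse ds ds' => //; lia.
Qed.

Lemma coverable_chain_cover (m n p : nat) : coverable R m n p <->
  exists k l, (k + l <= p)%N /\ chain_cover m n k l.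
Proof.
split=> [[q [qp [P [PP RP]]]]|[k [l [klp [U [c [cb ci cd]]]]]]].
  have [m0|m_gt0] := posnP m.
    by exists 0%N, 0%N; split=> //; apply: chain_cover_columns; lia.
  have [n0|n_gt0] := posnP n.
    by exists 0%N, 0%N; split=> //; apply/chain_cover_tr/chain_cover_columns; lia.
  have /choice[t tP] := fun i => monotonous_chain (PP i).1.
  have hit x y : (x < m)%N -> (y < n)%N ->
      exists i, (x.+1%:Z, y.+1%:Z) \in (t i).2.
    move=> xm yn; have := cell_sub_rect xm yn (center_cell x y).
    rewrite RP => -[i _]; rewrite (tP i).2 => -[d ds /center_cell_inj dE].
    by exists i; rewrite -dE.
  have [i0 _] := hit _ _ m_gt0 n_gt0.
  (* A cell may lie in several polyominoes, and one is picked; the default [i0] never occurs inside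
     the rectangle. *)
  pose idx x y := odflt i0 [pick i | (x.+1%:Z, y.+1%:Z) \in (t i).2].
  have idxP x y : (x < m)%N -> (y < n)%N ->
      (x.+1%:Z, y.+1%:Z) \in (t (idx x y)).2.
    move=> xm yn; rewrite /idx; case: pickP => [i //|none].
    by have [i] := hit _ _ xm yn; rewrite none.
  pose I b := [seq i <- enum 'I_q | (t i).1 == b].
  have mem_I i : i \in I (t i).1 by rewrite mem_filter eqxx mem_enum.
  have mem_Ib i b : (t i).1 = b -> i \in I b by move=> <-.
  exists (size (I true)), (size (I false)); split.
    rewrite !size_filter (_ : count (fun i => (t i).1 == false) _ =
      count (predC (fun i => (t i).1 == true)) (enum 'I_q)).
      by rewrite count_predC size_enum_ord.
    by apply: eq_count => i /=; case: (t i).1.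
  exists (fun x y => (t (idx x y)).1),
    (fun x y => index (idx x y) (I (t (idx x y)).1)).
  split.
  - by move=> x y xm yn; have := mem_I (idx x y); case: (t _).1; rewrite -index_mem.
  - move=> x y x' y' xx' yy' b b'; rewrite b b' => /index_inj e.
    have {}e := e i0 (mem_Ib _ _ b) (mem_Ib _ _ b').
    have := (tP (idx x y)).1 _ _ (idxP x y ltac:(lia) ltac:(lia)).
    rewrite b e => /(_ _ (idxP x' y' ltac:(lia) ltac:(lia))) /=; lia.
  - move=> x y x' y' xx' yy' /negbTE b /negbTE b'.
    rewrite b b' => /index_inj e.
    have {}e := e i0 (mem_Ib _ _ b) (mem_Ib _ _ b').
    have := (tP (idx x y)).1 _ _ (idxP x y ltac:(lia) ltac:(lia)).
    rewrite b e => /(_ _ (idxP x' y' ltac:(lia) ltac:(lia))) /=; lia.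
have [m0|m_gt0] := posnP m.
  exists 0%N; split=> //; exists (fun=> set0); split; first by case.
  rewrite /rect m0 min0n eqxx predeqE => z; split=> // -[[]] //.
have [n0|n_gt0] := posnP n.
  exists 0%N; split=> //; exists (fun=> set0); split; first by case.
  rewrite /rect n0 minn0 eqxx predeqE => z; split=> // -[[]] //.
exists (k + l)%N; split=> //.
(* Decreasing chains are numbered after the increasing ones; a number that no cell carries still
   yields a polyomino. *)
have /choice[P PP] : forall i : 'I_(k + l), exists P : set (R * R),
    [/\ monotonous P, P `<=` rect R m n &
      forall x y, (x < m)%N -> (y < n)%N ->
        (if U x y then c x y else k + c x y)%N = i ->
        cell R (x.+1%:Z, y.+1%:Z) `<=` P].
  move=> i.
  have [|P [P1 P2 P3]] := @chain_polyomino (i < k)%N m n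
    (fun x y => (if U x y then c x y else k + c x y)%N == i) m_gt0 n_gt0.
    move=> x y x' y' xx' yn yn'.
    have := cb x y ltac:(lia) yn; have := cb x' y' ltac:(lia) yn'.
    have := ci x y x' y'; have := cd x y x' y'.
    by case: (U x y); case: (U x' y'); case: ifP => /=; lia.
  by exists P; split=> // x y xm yn /eqP; exact: P3.
exists P; split=> [i|]; first by have [] := PP i.
rewrite predeqE => z; split=> [/rect_cell[x [y [xm yn zc]]]|[i _]]; last first.
  by have [_ + _] := PP i; apply.
have lkl : ((if U x y then c x y else k + c x y) < k + l)%N.
  by have := cb x y xm yn; case: ifP; lia.
by exists (Ordinal lkl) => //; have [_ _] := PP (Ordinal lkl); apply; eauto.
Qed.
End Geometry.

(** * From the numerical criterion to the two formulas *)

(* By truncated subtraction, the right-hand side holds if [p >= m] or [p >= n]. *)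
Lemma coverable_width (R : realType) (m n p : nat) :
  coverable R m n p <-> (4 * (m - p) * (n - p) <= p * p)%N.
Proof.
by split=> [/coverable_chain_cover/chain_cover_width |
  /chain_cover_width/coverable_chain_cover].
Qed.

Lemma floor_divn (R : realType) (a d : nat) : (0 < d)%N ->
  Num.floor (a%:R / d%:R : R) = (a %/ d)%N%:Z.
Proof.
move=> d0; apply: floor_def; have d0' : (0 < d%:R :> R) by rewrite ltr0n.
rewrite -PoszD addn1 -!pmulrn ler_pdivlMr // ltr_pdivrMr // -!natrM.
by rewrite ler_nat ltr_nat leq_trunc_div ltn_ceil.
Qed.

(** The number on the left is the smaller root of [4 (m - p) (n - p) = p^2]. Any [p] beyond the
    larger root exceeds [min(m, n)], where truncation makes the right-hand side true. *)
Lemma width_root (R : realType) (m n p : nat) :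
  (2 / 3 * (m%:R + n%:R
     - Num.sqrt (m%:R ^+ 2 + n%:R ^+ 2 - m%:R * n%:R)) <= p%:R :> R) =
  (4 * (m - p) * (n - p) <= p * p)%N.
Proof.
set D := _ - _ * _; have D0 : 0 <= D by rewrite /D; nra.
have -> : (2 / 3 * (m%:R + n%:R - Num.sqrt D) <= p%:R :> R) =
    (m%:R + n%:R - 3 / 2 * p%:R <= Num.sqrt D) by lra.
have ler_sqrtE (x : R) : (x <= Num.sqrt D) = (x <= 0) || (x ^+ 2 <= D).
  have [x0|x0] := lerP x 0; first by rewrite (le_trans x0) ?sqrtr_ge0.
  by rewrite -[x in LHS](ger0_norm (ltW x0)) -sqrtr_sqr ler_sqrt.
rewrite {}ler_sqrtE.
(* The difference of the two sides on the left is 3/4 of that on the right. *)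
have -> : ((m%:R + n%:R - 3 / 2 * p%:R) ^+ 2 <= D) =
    (4 * (m%:R - p%:R) * (n%:R - p%:R) <= p%:R * p%:R :> R).
  by rewrite /D; lra.
(* For [p >= min(m, n)]: the product is at most 0 if [b > c], and otherwise at most
   [(2 c - a - b)^2 <= c^2 / 4]. *)
have small (a b c : R) : 0 <= a -> 0 <= b -> a <= c ->
    (a + b - 3 / 2 * c <= 0) || (4 * (a - c) * (b - c) <= c * c).
  move=> a0 b0 ac; have [//|abc /=] := lerP (a + b - 3 / 2 * c) 0.
  by have [bc|cb] := lerP b c; nra.
have [mp|pm] := leqP m p.
  by rewrite (eqP (mp : m - p == 0)%N) muln0 mul0n leq0n small ?ler_nat.
have [np|pn] := leqP n p.
  rewrite (eqP (np : n - p == 0)%N) muln0 leq0n (addrC m%:R) (mulrAC 4).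
  by rewrite small ?ler_nat.
have -> : (m%:R + n%:R - 3 / 2 * p%:R <= 0 :> R) = false.
  have : p%:R < m%:R :> R by rewrite ltr_nat.
  have : p%:R < n%:R :> R by rewrite ltr_nat.
  have : 0 <= p%:R :> R by [].
  lra.
by rewrite /= -!natrB ?(ltnW pm) ?(ltnW pn) // -!natrM ler_nat.
Qed.

Theorem theorem1 (R : realType) :
  (forall n p : nat, (p < n)%N ->
     max_width R n p =
     (p%:R + (Num.floor (p%:R ^+ 2 / (4 * (n%:R - p%:R)) : R))%:~R)%:E) /\
  (forall m n : nat,
     (min_cover R m n)%:Z =
     Num.ceil (2 / 3 * (m%:R + n%:R
       - Num.sqrt (m%:R ^+ 2 + n%:R ^+ 2 - m%:R * n%:R)) : R)).
Proof.
split=> [n p pn|m n].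
  have d0 : (0 < 4 * (n - p))%N by lia.
  have coverE m : coverable R m n p <-> (m <= p + (p * p) %/ (4 * (n - p)))%N.
    rewrite -leq_subLR leq_divRL // mulnA (mulnC _ 4).
    exact: coverable_width.
  rewrite -natrB ?(ltnW pn) // -natrX -mulnn -natrM floor_divn //.
  rewrite -pmulrn -natrD.
  apply/eqP; rewrite eq_le; apply/andP; split.
    by apply: ge_ereal_sup => _ [m /coverE mM <-]; rewrite lee_fin ler_nat.
  apply: ereal_sup_ubound; exists (p + p * p %/ (4 * (n - p)))%N => //=.
  by apply/coverE.
rewrite /min_cover; case: ex_minnP => p /asboolP/coverable_width pP minp.
apply/eqP; rewrite eq_le; apply/andP; split; last first.
  by rewrite ceil_le_int -pmulrn width_root.
set x := Num.ceil _.
(* Minimality of [p] concerns natural numbers, so the ceiling must be nonnegative: the radicand is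
   at most [(m + n)^2]. *)
have x0 : 0 <= x.
  rewrite ceil_ge0 (lt_le_trans (_ : -1 < 0)) // mulr_ge0 // subr_ge0.
  rewrite -[leRHS]ger0_norm // -sqrtr_sqr ler_sqrt ?sqr_ge0 //.
  have : 0 <= m%:R * n%:R :> R by [].
  by lra.
have [q xq] : exists q : nat, x = q%:Z by exists `|x|%N; rewrite gez0_abs.
rewrite xq lez_nat; apply: minp; apply/asboolP/coverable_width.
by rewrite -(width_root R) (pmulrn 1 q) -xq -ceil_le_int.
Qed.
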